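(* Let $\Omega\in\mathcal B(\mathbb R^n)$, let $C\subset\overline\Omega$ be a density set of $\Omega$, and let $\lambda\in\mathrm{ba}(\Omega,\mathcal B(\Omega),\mathcal L^n)$ satisfy $\lambda\ge0$ and $\lambda(C_\delta\cap\Omega)>0$ for all $\delta>0$. Then there exists a $\lambda$-density $\mu\in\mathrm{Dens}_C$ at $C$, i.e. there is a density measure $\mu$ at $C$ on $\Omega$ such that $$\liminf_{\delta\downarrow0}\frac{\lambda(A\cap\Omega\cap C_\delta)}{\lambda(\Omega\cap C_\delta)}\le\mu(A)\le\limsup_{\delta\downarrow0}\frac{\lambda(A\cap\Omega\cap C_\delta)}{\lambda(\Omega\cap C_\delta)}\qquad\text{for all }A\in\mathcal B(\Omega).$$
   Context: $\mathcal L^n$ is Lebesgue measure on $\mathbb R^n$, $\mathcal B(\Omega)$ the Borel subsets of $\Omega$. A measure on $\Omega$ means a finitely additive set function on $\mathcal B(\Omega)$ vanishing at $\emptyset$. $\mathrm{ba}(\Omega,\mathcal B(\Omega),\mathcal L^n)$ is the space of bounded real-valued finitely additive measures $\mu$ on $\mathcal B(\Omega)$ such that $\mu(A)=0$ whenever $\mathcal L^n(A)=0$. $C_\delta$ denotes the open $\delta$-neighborhood of $C$ in $\mathbb R^n$. A set $C\subset\overline\Omega$ is a density set of $\Omega$ if $C$ is nonempty and closed in $\mathbb R^n$, $\mathcal L^n(C\cap\Omega)=0$, and $\mathcal L^n(C_\delta\cap\Omega)>0$ for all $\delta>0$. A measure $\mu\in\mathrm{ba}(\Omega,\mathcal B(\Omega),\mathcal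 L^n)$ is a density measure at $C$ (on $\Omega$) if $\mu\ge 0$ and $\mu(C_\delta\cap\Omega)=\mu(\Omega)=1$ for all $\delta>0$; $\mathrm{Dens}_C$ is the set of all of these. *)

(* Defs.v *)
From HB Require Import structures.
From mathcomp Require Import all_boot all_order all_algebra.
From mathcomp Require Import all_classical all_reals all_analysis.

Set Implicit Arguments.
Unset Strict Implicit.
Unset Printing Implicit Defensive.

Import Order.TTheory GRing.Theory Num.Theory.
Import numFieldNormedType.Exports.

Local Open Scope classical_set_scope.
Local Open Scope ring_scope.

Definition borel (R : realType) (n : nat) : set (set 'rV[R]_n) :=
  <<s [set U : set 'rV[R]_n | open U] >>.

Definition borel_of (R : realType) (n : nat) (Omega : set 'rV[R]_n) :
    set (set 'rV[R]_n) :=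
  [set A | borel A /\ A `<=` Omega].

(* n-fold product of the one-dimensional Lebesgue measure, as an iterated
   integral of sections (compare product_measure1); 'rV[R]_0 is one point, of
   mass 1. It is meaningful on Borel sets only, the only sets it is used on. *)
Fixpoint lebesgue_rV (R : realType) (n : nat) : set 'rV[R]_n -> \bar R :=
  match n with
  | 0 => fun A => (\1_A (0 : 'rV[R]_0))%:E
  | m.+1 => fun A : set 'rV[R]_(1 + m) =>
      (\int[lebesgue_measure]_(x in [set: R])
         lebesgue_rV [set v : 'rV[R]_m | A (row_mx (const_mx x : 'rV_1) v)])%E
  end.

(* The library norm on 'rV[R]_n is the maximum norm, hence an explicit
   Euclidean distance; both induce the same topology. *)
Definition euclidean_dist (R : realType) (n : nat) (x y : 'rV[R]_n) : R :=
  Num.sqrt (\sum_(i < n) (x ord0 i - y ord0 i) ^+ 2).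

Definition nbhd (R : realType) (n : nat) (C : set 'rV[R]_n) (delta : R) :
    set 'rV[R]_n :=
  [set x | exists2 c, C c & euclidean_dist x c < delta].

(* Set functions on B(Omega) are represented by total functions
   mu : set 'rV[R]_n -> R whose values outside borel_of Omega are irrelevant. *)
Definition ba (R : realType) (n : nat) (Omega : set 'rV[R]_n) :
    set (set 'rV[R]_n -> R) :=
  [set mu | [/\ mu set0 = 0,
     (forall A B, borel_of Omega A -> borel_of Omega B -> A `&` B = set0 ->
        mu (A `|` B) = mu A + mu B),
     (exists M, forall A, borel_of Omega A -> `|mu A| <= M)
   & (forall A, borel_of Omega A -> lebesgue_rV A = 0%E -> mu A = 0)]].

Definition nonneg_on (R : realType) (n : nat) (Omega : set 'rV[R]_n)
    (mu : set 'rV[R]_n -> R) : Prop :=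
  forall A, borel_of Omega A -> 0 <= mu A.

Definition density_set (R : realType) (n : nat) (Omega C : set 'rV[R]_n) :
    Prop :=
  [/\ C `<=` closure Omega, C !=set0, closed C,
      lebesgue_rV (C `&` Omega) = 0%E
    & forall delta, 0 < delta -> (0 < lebesgue_rV (nbhd C delta `&` Omega))%E].

Definition Dens (R : realType) (n : nat) (Omega C : set 'rV[R]_n) :
    set (set 'rV[R]_n -> R) :=
  [set mu | [/\ ba Omega mu, nonneg_on Omega mu
   & forall delta, 0 < delta ->
       mu (nbhd C delta `&` Omega) = mu Omega /\ mu Omega = 1]].

Definition density_ratio (R : realType) (n : nat) (Omega C : set 'rV[R]_n)
    (lambda : set 'rV[R]_n -> R) (A : set 'rV[R]_n) (delta : R) : R :=
  lambda (A `&` Omega `&` nbhd C delta) / lambda (Omega `&` nbhd C delta).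

(* Main.v *)
Require Import Defs.
From mathcomp Require Import all_boot all_order all_algebra.
From mathcomp Require Import all_classical all_reals all_analysis.
Set Implicit Arguments.
Unset Strict Implicit.
Unset Printing Implicit Defensive.

Import Order.TTheory GRing.Theory Num.Theory.
Import numFieldNormedType.Exports.

(** The measure is a generalized limit of the averages
      [lambda (A `&` Omega `&` C_d) / lambda (Omega `&` C_d)]
    as [d] tends to 0 from the right. Take an ultrafilter [U] finer than the
    filter of right neighbourhoods of 0, and let [ultra_density A] be the limit
    along [U] of this quotient. The quotient lies in the compact interval
    [[0, 1]] ([density_ratio_itv]), and a function with values in a compact
    interval always converges along an ultrafilter ([ultra_bounded_cvg]), so
    the limit exists for every Borel set at once.

    For fixed [d > 0] the quotient is a finitely additive probability on the Borel
    subsets of [Omega], absolutely continuous because [lambda] is; these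
    properties are closed under limits. It gives mass 1 to [C_e] as soon as
    [d <= e], whence concentration at [C]. Finally a limit along a finer filter
    lies between the lower and the upper limit along the coarser one
    ([limf_einf_le_lim], [lim_le_limf_esup]).

    Evaluating [lambda] on [A `&` Omega `&` C_d] requires [C_d] to be Borel; it
    is open because the Euclidean distance is continuous for the topology of
    row vectors ([continuous_euclidean_dist]). *)

Local Open Scope classical_set_scope.
Local Open Scope ring_scope.

(** * Limits along ultrafilters and finer filters *)

(** By compactness of the interval [f @ U] has a cluster point; since [U]
    contains the preimage of each neighbourhood or its complement, and the
    latter is excluded by clustering, [f @ U] converges to it. *)
Lemma ultra_bounded_cvg (R : realType) (T : Type) (U : set_system T)
    (UU : UltraFilter U) (f : T -> R) (a b : R) :
  (\forall x \near U, a <= f x <= b) -> cvg (f @ U).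
Proof.
move=> fab.
have [p [_ clp]] : `[a, b] `&` cluster (f @ U) !=set0.
  apply: segment_compact; apply: filterS fab => x /=.
  by rewrite in_itv.
apply/cvg_ex; exists p => B Bp.
have [//|UB] := in_ultra_setVsetC (f @^-1` B) UU.
by have [y [nBy By]] := clp (~` B) B UB Bp.
Qed.

(** Each set of [F] belongs to [G], so the supremum of [f] over it bounds the
    limit along [G]. *)
Lemma lim_le_limf_esup (R : realType) (T : choiceType) (X : filteredType T)
    (F G : set_system X) (PG : ProperFilter G) (f : X -> R) :
  F `<=` G -> cvg (f @ G) ->
  ((lim (f @ G))%:E <= limf_esup (fun x => (f x)%:E) F)%E.
Proof.
move=> FG cf; apply: le_ereal_inf_tmp => _ [V /FG GV <-].
have fle x : V x -> ((f x)%:E <= ereal_sup [set (f y)%:E | y in V])%E.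
  by move=> Vx; apply: ereal_sup_ubound; exists x.
case: (ereal_sup _) fle => [s||] fle; last first.
(* The supremum is not -oo because V, being in a proper filter, is nonempty. *)
- by have [x /fle] := filter_ex GV.
- by rewrite leey.
rewrite lee_fin; apply: limr_le => //.
by apply: filterS GV => x /fle; rewrite lee_fin.
Qed.

Lemma limf_einf_le_lim (R : realType) (T : choiceType) (X : filteredType T)
    (F G : set_system X) (PG : ProperFilter G) (f : X -> R) :
  F `<=` G -> cvg (f @ G) ->
  (limf_einf (fun x => (f x)%:E) F <= (lim (f @ G))%:E)%E.
Proof.
move=> FG cf; rewrite /limf_einf leeNl -EFinN -limN //.
have := @lim_le_limf_esup R T X F G PG (fun x => - f x) FG.
by apply; exact: is_cvgN.
Qed.

(** * Borel sets and Euclidean neighbourhoods *)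

Lemma continuous_euclidean_dist (R : realType) (n : nat) (c : 'rV[R]_n) :
  continuous (fun x : 'rV[R]_n => euclidean_dist x c).
Proof.
move=> x; rewrite /euclidean_dist.
apply: (@continuous_comp _ _ _
  (fun x : 'rV[R]_n => \sum_(i < n) (x ord0 i - c ord0 i) ^+ 2) Num.sqrt);
  last exact: sqrt_continuous.
have cD : continuous (fun u : R * R => u.1 + u.2) by exact: add_continuous.
move: x; apply: (continuous_big cD) => i _ x.
apply: (@continuous_comp _ _ _
  (fun x : 'rV[R]_n => x ord0 i - c ord0 i) (fun t => t ^+ 2));
  last exact: exprn_continuous.
by apply: continuousB; [exact: coord_continuous | exact: cst_continuous].
Qed.

Lemma open_nbhd (R : realType) (n : nat) (C : set 'rV[R]_n) (delta : R) :
  open (nbhd C delta).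
Proof.
rewrite (_ : nbhd C delta =
    \bigcup_(c in C) (fun x => euclidean_dist x c) @^-1` [set t | t < delta]).
  apply: bigcup_open => c _.
  apply: open_comp; last exact: open_lt.
  by move=> x _; exact: continuous_euclidean_dist.
by apply/seteqP; split=> x [c Cc xc]; exists c.
Qed.

Lemma borelI (R : realType) (n : nat) (A B : set 'rV[R]_n) :
  borel A -> borel B -> borel (A `&` B).
Proof.
exact: (@measurableI _ (g_sigma_algebraType [set U : set 'rV[R]_n | open U])).
Qed.

Lemma borel_ofI (R : realType) (n : nat) (Omega A B : set 'rV[R]_n) :
  borel_of Omega A -> borel B -> borel_of Omega (A `&` B).
Proof.
move=> [bA AO] bB; split; first exact: borelI.
by move=> x [/AO].
Qed.

Lemma borel_nbhd (R : realType) (n : nat) (C : set 'rV[R]_n) (delta : R) :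
  borel (nbhd C delta).
Proof. by apply: sub_sigma_algebra; exact: open_nbhd. Qed.

Lemma le_nbhd (R : realType) (n : nat) (C : set 'rV[R]_n) (d e : R) :
  d <= e -> nbhd C d `<=` nbhd C e.
Proof. by move=> de x [c Cc xc]; exists c => //; exact: lt_le_trans xc de. Qed.

Lemma ba_monotone (R : realType) (n : nat) (Omega : set 'rV[R]_n)
    (lambda : set 'rV[R]_n -> R) (A B : set 'rV[R]_n) :
  ba Omega lambda -> nonneg_on Omega lambda ->
  borel_of Omega A -> borel_of Omega B -> A `<=` B -> lambda A <= lambda B.
Proof.
move=> [_ ladd _ _] lge0 OA OB AB.
have OBA : borel_of Omega (B `\` A).
  by rewrite setDE; apply: borel_ofI => //; apply: sigma_algebraC; case: OA.
rewrite -(setDUK AB) ladd ?lerDl ?lge0 //.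
by rewrite setDE setICA setICr setI0.
Qed.

(** * The limit of the density ratios along an ultrafilter *)

Section ultrafilter_density.
Variables (R : realType) (n : nat) (Omega C : set 'rV[R]_n).
Variable lambda : set 'rV[R]_n -> R.
Hypothesis bO : borel Omega.
Hypothesis ba_lambda : ba Omega lambda.
Hypothesis lambda_ge0 : nonneg_on Omega lambda.
Hypothesis lambda_gt0 :
  forall delta : R, 0 < delta -> 0 < lambda (nbhd C delta `&` Omega).

Let borel_of_self : borel_of Omega Omega. Proof. by split. Qed.

Let borel_of_nbhd (A : set 'rV[R]_n) (d : R) :
  borel_of Omega A -> borel_of Omega (A `&` Omega `&` nbhd C d).
Proof.
move=> OA; apply: borel_ofI; last exact: borel_nbhd.
exact: borel_ofI.
Qed.

Lemma density_ratio_itv (A : set 'rV[R]_n) (d : R) :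
  borel_of Omega A -> 0 < d -> 0 <= density_ratio Omega C lambda A d <= 1.
Proof.
move=> OA d0; have D0 := lambda_gt0 d0; rewrite setIC in D0.
rewrite /density_ratio divr_ge0 ?(ltW D0) ?lambda_ge0 //=; last first.
  exact: borel_of_nbhd.
rewrite ler_pdivrMr // mul1r; apply: (ba_monotone ba_lambda) => //.
- exact: borel_of_nbhd.
- by apply: borel_ofI => //; exact: borel_nbhd.
- by move=> x [[]].
Qed.

Lemma density_ratioU (A B : set 'rV[R]_n) (d : R) :
  borel_of Omega A -> borel_of Omega B -> A `&` B = set0 ->
  density_ratio Omega C lambda (A `|` B) d =
  density_ratio Omega C lambda A d + density_ratio Omega C lambda B d.
Proof.
move=> OA OB AB0; have [_ ladd _ _] := ba_lambda.
rewrite /density_ratio !setIUl ladd ?mulrDl //; try exact: borel_of_nbhd.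
by apply/seteqP; split=> // x [[[Ax _] _] [[Bx _] _]]; rewrite -AB0.
Qed.

Lemma density_ratio_nbhd (d e : R) : 0 < d -> d <= e ->
  density_ratio Omega C lambda (nbhd C e `&` Omega) d = 1.
Proof.
move=> d0 de; rewrite /density_ratio.
rewrite (_ : nbhd C e `&` Omega `&` Omega `&` nbhd C d = Omega `&` nbhd C d).
  by rewrite divff // gt_eqF // setIC lambda_gt0.
by apply/seteqP; split=> x [Ox Cx]; [case: Ox | do !split=> //; exact: le_nbhd Cx].
Qed.

(** Absolute continuity passes to the ratios by monotonicity of [lambda]: a
    Lebesgue-null [A] has [lambda A = 0], hence so does its part in [C_d]. *)
Lemma density_ratio_null (A : set 'rV[R]_n) (d : R) :
  borel_of Omega A -> lambda A = 0 -> density_ratio Omega C lambda A d = 0.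
Proof.
move=> OA A0; rewrite /density_ratio (_ : lambda _ = 0) ?mul0r //.
apply/eqP; rewrite eq_le lambda_ge0 ?andbT; last exact: borel_of_nbhd.
rewrite -A0; apply: (ba_monotone ba_lambda) => //; first exact: borel_of_nbhd.
by move=> x [[]].
Qed.

Variable U : set_system R.
Hypothesis UU : UltraFilter U.
Hypothesis right0U : 0^'+ `<=` U.

Definition ultra_density (A : set 'rV[R]_n) : R :=
  lim (density_ratio Omega C lambda A @ U).

Let U_gt0 : \forall d \near U, 0 < d.
Proof. by apply: right0U; exact: nbhs_right_gt. Qed.

Lemma density_ratio_cvg (A : set 'rV[R]_n) :
  borel_of Omega A -> cvg (density_ratio Omega C lambda A @ U).
Proof.
move=> OA; apply: (@ultra_bounded_cvg _ _ _ _ _ 0 1).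
by apply: filterS U_gt0 => d; exact: density_ratio_itv.
Qed.

Lemma ultra_density_itv (A : set 'rV[R]_n) :
  borel_of Omega A -> 0 <= ultra_density A <= 1.
Proof.
move=> OA; have cA := density_ratio_cvg OA.
by apply/andP; split; [apply: limr_ge|apply: limr_le] => //;
  apply: filterS U_gt0 => d /(density_ratio_itv OA) /andP[].
Qed.

(** Eventual constancy at [0^'+] suffices, as [U] is finer; it yields every
    explicit value of [ultra_density] below. *)
Lemma ultra_density_near_cst (A : set 'rV[R]_n) (l : R) :
  (\forall d \near 0^'+, density_ratio Omega C lambda A d = l) ->
  ultra_density A = l.
Proof. by move=> /right0U Al; apply: lim_near_cst. Qed.

Lemma ultra_density_nbhd (e : R) : 0 < e ->
  ultra_density (nbhd C e `&` Omega) = 1.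
Proof.
move=> e0; apply: ultra_density_near_cst; near=> d.
by apply: density_ratio_nbhd; near: d; [exact: nbhs_right_gt|exact: nbhs_right_le].
Unshelve. all: by end_near. Qed.

Lemma ultra_densityT : ultra_density Omega = 1.
Proof.
apply: ultra_density_near_cst; near=> d.
have d0 : 0 < d by near: d; exact: nbhs_right_gt.
by rewrite /density_ratio setIid divff // gt_eqF // setIC lambda_gt0.
Unshelve. all: by end_near. Qed.

Lemma ultra_density_null (A : set 'rV[R]_n) :
  borel_of Omega A -> lambda A = 0 -> ultra_density A = 0.
Proof.
move=> OA A0; apply: ultra_density_near_cst; near=> d.
exact: density_ratio_null.
Unshelve. all: by end_near. Qed.

Lemma ultra_densityU (A B : set 'rV[R]_n) :
  borel_of Omega A -> borel_of Omega B -> A `&` B = set0 ->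
  ultra_density (A `|` B) = ultra_density A + ultra_density B.
Proof.
move=> OA OB AB0; rewrite /ultra_density -limD; try exact: density_ratio_cvg.
by congr (lim (_ @ U)); apply/funext => d; exact: density_ratioU.
Qed.

Lemma ultra_density_Dens : Dens Omega C ultra_density.
Proof.
have [l0 _ _ lnull] := ba_lambda.
have O0 : borel_of Omega set0 by split=> //; exact: sigma_algebra0.
split=> [|A /ultra_density_itv/andP[]//|e e0]; last first.
  by rewrite ultra_density_nbhd // ultra_densityT.
split.
- exact: ultra_density_null.
- exact: ultra_densityU.
- exists 1 => A /ultra_density_itv/andP[mu0 mu1].
  by rewrite ger0_norm.
- by move=> A OA /(lnull _ OA); exact: ultra_density_null.
Qed.

End ultrafilter_density.

Theorem proposition3p5 (R : realType) (n : nat) (Omega C : set 'rV[R]_n)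
    (lambda : set 'rV[R]_n -> R) :
  borel Omega ->
  density_set Omega C ->
  ba Omega lambda ->
  nonneg_on Omega lambda ->
  (forall delta : R, 0 < delta -> 0 < lambda (nbhd C delta `&` Omega)) ->
  exists mu : set 'rV[R]_n -> R,
    Dens Omega C mu /\
    forall A : set 'rV[R]_n, borel_of Omega A ->
      (limf_einf (fun delta => (density_ratio Omega C lambda A delta)%:E) 0^'+
         <= (mu A)%:E
         <= limf_esup (fun delta => (density_ratio Omega C lambda A delta)%:E)
              0^'+)%E.
Proof.
move=> bO _ ba_l l_ge0 l_gt0.
have [U [UU right0U]] := ultraFilterLemma (at_right_proper_filter (0 : R)).
exists (ultra_density Omega C lambda U); split.
  exact: ultra_density_Dens.
move=> A OA; have cA : cvg (density_ratio Omega C lambda A @ U).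
  exact: density_ratio_cvg.
have PU : ProperFilter U by exact: ultra_proper.
by apply/andP; split;
  [exact: (limf_einf_le_lim PU right0U) | exact: (lim_le_limf_esup PU right0U)].
Qed.
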